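(* Let $\phi\in\mathfrak{gl}(n,\mathbb R)$ be nonderogatory and let $\mathcal G_\phi:=\mathbb R[\phi]\ltimes\mathbb R^n$. The following are equivalent. (1) Every derivation of $\mathcal G_\phi$ is an inner derivation. (2) $\mathbb R[\phi]$ is a Cartan subalgebra of $\mathfrak{gl}(n,\mathbb R)$. (3) $\phi$ has $n$ distinct (real or complex) eigenvalues. (4) The nilradical of $\mathcal G_\phi$ is Abelian. (5) $\mathcal G_\phi$ is isomorphic to a direct sum of only copies of $\mathfrak{aff}(\mathbb R)$ and $\mathfrak{aff}(\mathbb C)$.
   Context: $\phi$ is nonderogatory if its characteristic and minimal polynomials coincide (up to sign). $\mathbb R[\phi]$ is the commutative algebra of real polynomials in $\phi$, and $\mathbb R[\phi]\ltimes\mathbb R^n$ is the vector space $\mathbb R[\phi]\oplus\mathbb R^n$ with bracket $[a,b]=0$, $[x,y]=0$, $[a,x]=ax$ for $a,b\in\mathbb R[\phi]$, $x,y\in\mathbb R^n$. A Cartan subalgebra of a Lie algebra is a nilpotent subalgebra equal to its own normalizer. The nilradical is the largest nilpotent ideal. $\mathfrak{aff}(\mathbb R)$ is the 2-dimensional real Lie algebra with basis $(e_1,e_2)$ and $[e_1,e_2]=e_2$. $\mathfrak{aff}(\mathbb C)$ is the 4-dimensional real Lie algebra with basis $(e_1,\dots,e_4)$ and nonzero brackets $[e_1,e_3]=e_3$, $[e_1,e_4]=e_4$, $[e_2,e_3]=e_4$, $[e_2,e_4]=-e_3$. *)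

(* Defs.v *)
From HB Require Import structures.
From mathcomp Require Import all_boot all_order all_algebra all_field.
From mathcomp Require Import reals.
From mathcomp Require Import complex ring.

Set Implicit Arguments.
Unset Strict Implicit.
Unset Printing Implicit Defensive.

Import GRing.Theory.
Local Open Scope ring_scope.

HB.mixin Record isLieAlgebra (K : fieldType) V of Vector K V := {
  bracket : V -> V -> V;
  bracket_linearl : forall (a : K) (x y z : V),
    bracket (a *: x + y) z = a *: bracket x z + bracket y z;
  bracket_linearr : forall (a : K) (x y z : V),
    bracket z (a *: x + y) = a *: bracket z x + bracket z y;
  bracketxx : forall x : V, bracket x x = 0;
  bracket_jacobi : forall x y z : V,
    bracket x (bracket y z) + bracket y (bracket z x)
      + bracket z (bracket x y) = 0
}.

#[short(type="lieAlgType")]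
HB.structure Definition LieAlgebra (K : fieldType) :=
  { V of Vector K V & isLieAlgebra K V }.

(* [U, W], the span of all brackets [u, w] with u in U and w in W; that bases *)
(* suffice is bracketv_leP below.                                             *)
Definition bracketv (K : fieldType) (L : lieAlgType K) (U W : {vspace L}) :
    {vspace L} :=
  <<[seq bracket u w | u <- vbasis U, w <- vbasis W]>>%VS.

Definition lie_subalgebra (K : fieldType) (L : lieAlgType K)
    (U : {vspace L}) : Prop :=
  forall x y, x \in U -> y \in U -> bracket x y \in U.

Definition lie_ideal (K : fieldType) (L : lieAlgType K)
    (U : {vspace L}) : Prop :=
  forall x y, y \in U -> bracket x y \in U.

Definition lie_abelian (K : fieldType) (L : lieAlgType K)
    (U : {vspace L}) : Prop :=
  forall x y, x \in U -> y \in U -> bracket x y = 0.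

Definition lower_central (K : fieldType) (L : lieAlgType K)
    (U : {vspace L}) (k : nat) : {vspace L} :=
  iter k (bracketv U) U.

Definition lie_nilpotent (K : fieldType) (L : lieAlgType K)
    (U : {vspace L}) : Prop :=
  exists k, lower_central U k = 0%VS.

Definition in_normalizer (K : fieldType) (L : lieAlgType K)
    (U : {vspace L}) (x : L) : Prop :=
  forall y, y \in U -> bracket x y \in U.

Definition cartan_subalgebra (K : fieldType) (L : lieAlgType K)
    (H : {vspace L}) : Prop :=
  [/\ lie_subalgebra H, lie_nilpotent H &
      forall x, x \in H <-> in_normalizer H x].

Definition is_nilradical (K : fieldType) (L : lieAlgType K)
    (N : {vspace L}) : Prop :=
  [/\ lie_ideal N, lie_nilpotent N &
      forall I : {vspace L}, lie_ideal I -> lie_nilpotent I -> (I <= N)%VS].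

Definition derivation (K : fieldType) (L : lieAlgType K)
    (D : 'End(L)) : Prop :=
  forall x y, D (bracket x y) = bracket (D x) y + bracket x (D y).

Definition inner_derivation (K : fieldType) (L : lieAlgType K)
    (D : 'End(L)) : Prop :=
  exists z, forall x, D x = bracket z x.

Definition lie_isomorphic (K : fieldType) (L M : lieAlgType K) : Prop :=
  exists f : {linear L -> M},
    bijective f /\ forall x y, f (bracket x y) = bracket (f x) (f y).

Section BracketTheory.
Context (K : fieldType) (L : lieAlgType K).

Definition bracketl (z x : L) : L := bracket z x.

HB.instance Definition _ (z : L) := GRing.isLinear.Build K L L _ (bracketl z)
  (fun a x y => bracket_linearr a x y z).

Definition bracketr (z x : L) : L := bracket x z.

HB.instance Definition _ (z : L) := GRing.isLinear.Build K L L _ (bracketr z)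
  (fun a x y => bracket_linearl a x y z).

Lemma bracketv_leP (U W X : {vspace L}) :
  (bracketv U W <= X)%VS <->
  (forall u w, u \in U -> w \in W -> bracket u w \in X).
Proof.
split=> [/span_subvP sX u w Uu Ww | XUW]; last first.
  apply/span_subvP => _ /allpairsP[[u w] [/vbasis_mem Uu /vbasis_mem Ww ->]].
  exact: XUW.
rewrite -[bracket u w]/(bracketr w u) (coord_vbasis Uu).
rewrite linear_sum memv_suml // => i _; rewrite linearZ memvZ //.
rewrite -[X in X \in _]/(bracketl (vbasis U)`_i w) (coord_vbasis Ww).
rewrite linear_sum memv_suml // => j _; rewrite linearZ memvZ //.
apply: sX; apply/allpairsP; exists ((vbasis U)`_i, (vbasis W)`_j).
by rewrite /= !mem_nth ?size_tuple.
Qed.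

End BracketTheory.

Section Gl.
Context (K : fieldType) (n : nat).
Implicit Types (A B C : 'M[K]_n).

Definition gl_bracket A B : 'M[K]_n := A *m B - B *m A.

Fact gl_linearl (a : K) A B C :
  gl_bracket (a *: A + B) C = a *: gl_bracket A C + gl_bracket B C.
Proof.
rewrite /gl_bracket mulmxDl mulmxDr -scalemxAl -scalemxAr scalerBr.
by rewrite opprD addrACA.
Qed.

Fact gl_linearr (a : K) A B C :
  gl_bracket C (a *: A + B) = a *: gl_bracket C A + gl_bracket C B.
Proof.
rewrite /gl_bracket mulmxDl mulmxDr -scalemxAl -scalemxAr scalerBr.
by rewrite opprD addrACA.
Qed.

Fact gl_bracketxx A : gl_bracket A A = 0.
Proof. exact: subrr. Qed.

Fact gl_jacobi A B C :
  gl_bracket A (gl_bracket B C) + gl_bracket B (gl_bracket C A)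
    + gl_bracket C (gl_bracket A B) = 0.
Proof.
rewrite /gl_bracket !(mulmxBl, mulmxBr) !mulmxA.
move: (A *m B *m C) (A *m C *m B) (B *m C *m A) (C *m B *m A) (B *m A *m C)
  (C *m A *m B) => a b c d e f.
apply/matrixP=> i j; rewrite !mxE; ring.
Qed.

HB.instance Definition _ := isLieAlgebra.Build K 'M[K]_n
  gl_linearl gl_linearr gl_bracketxx gl_jacobi.

End Gl.

(* K[phi], as the subalgebra of the matrix algebra generated by phi.          *)
Definition polyalg (K : fieldType) (n : nat) (phi : 'M[K]_n.+1) :
    {vspace 'M[K]_n.+1} := <<1; phi>>%VS.

Lemma polyalgP (K : fieldType) (n : nat) (phi A : 'M[K]_n.+1) :
  A \in polyalg phi <-> exists p : {poly K}, A = horner_mx phi p.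
Proof.
pose P (B : 'M[K]_n.+1) := exists p : {poly K}, B = horner_mx phi p.
have P0 : P 0 by exists 0; rewrite rmorph0.
have PD B C : P B -> P C -> P (B + C).
  by move=> [p ->] [q ->]; exists (p + q); rewrite rmorphD.
have PZ a B : P B -> P (a *: B) by move=> [p ->]; exists (a *: p); rewrite linearZ.
have PM B C : P B -> P C -> P (B * C).
  by move=> [p ->] [q ->]; exists (p * q); rewrite rmorphM.
have Pspan (X : seq 'M[K]_n.+1) :
    {in X, forall B, P B} -> {in <<X>>%VS, forall B, P B}.
  move=> PX B /(coord_span (X := in_tuple X)) ->.
  by apply: big_ind => // i _; apply: PZ; apply: PX; rewrite mem_nth.
have P1 : P 1 by exists 1; rewrite rmorph1.
have PU B : B \in (1 + <[phi]>)%VS -> P B.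
  case/memv_addP=> _ /vlineP[a ->] [_ /vlineP[b ->] ->].
  by apply: PD; apply: PZ => //; exists 'X; rewrite horner_mx_X.
have PUX i B : B \in ((1 + <[phi]>) ^+ i)%VS -> P B.
  elim: i B => [|i IH] B; first by rewrite expv0 => /vlineP[a ->]; apply: PZ.
  rewrite expvSl unlock; move: B; apply: Pspan => _ /allpairsP[[B C] [HB HC ->]].
  by apply: PM; [apply: PU (vbasis_mem HB) | apply: IH (vbasis_mem HC)].
split=> [/memv_sumP[v vP ->]|[p ->]].
  by apply: (big_ind P P0 PD) => i _; apply: (PUX i); apply: vP.
have phiA : phi \in polyalg phi by apply: memv_adjoin.
have oneA : 1 \in polyalg phi by rewrite memvE sub1_agenv.
elim/poly_ind: p => [|p c IHp]; first by rewrite rmorph0 mem0v.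
rewrite rmorphD rmorphM /= horner_mx_X horner_mx_C -scalemx1.
by rewrite memvD ?memvZ // -[polyalg phi]agenvM memv_mul.
Qed.

(* The semidirect product K[phi] |>< K^n: pairs (a, x), where a acts on the   *)
(* column vector x by a *m x.                                                 *)
Definition semidirect (K : fieldType) (n : nat) (phi : 'M[K]_n.+1) : Type :=
  (subvs_of (polyalg phi) * 'cV[K]_n.+1)%type.

Section Semidirect.
Context (K : fieldType) (n : nat) (phi : 'M[K]_n.+1).

HB.instance Definition _ := Vector.copy (semidirect phi)
  (subvs_of (polyalg phi) * 'cV[K]_n.+1)%type.

Implicit Types (g h k : semidirect phi).

Definition semidirect_bracket g h : semidirect phi :=
  (0, vsval g.1 *m h.2 - vsval h.1 *m g.2).

Fact semidirect_linearl (a : K) g h k :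
  semidirect_bracket (a *: g + h) k
    = a *: semidirect_bracket g k + semidirect_bracket h k.
Proof.
case: g h k => [g x] [h y] [k z]; rewrite /semidirect_bracket /=.
congr (_, _); first by rewrite /= scaler0 addr0.
rewrite /= !mulmxDl mulmxDr -scalemxAl -scalemxAr scalerBr opprD.
by rewrite addrACA.
Qed.

Fact semidirect_bracketC g h :
  semidirect_bracket g h = - semidirect_bracket h g.
Proof. by congr (_, _); rewrite /= ?oppr0 ?opprB. Qed.

Fact semidirect_linearr (a : K) g h k :
  semidirect_bracket k (a *: g + h)
    = a *: semidirect_bracket k g + semidirect_bracket k h.
Proof.
rewrite semidirect_bracketC semidirect_linearl opprD -scalerN.
by rewrite -!semidirect_bracketC.
Qed.

Fact semidirect_bracketxx g : semidirect_bracket g g = 0.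
Proof. by congr (_, _); rewrite /= subrr. Qed.

Fact polyalg_mulC (A B : 'M[K]_n.+1) :
  A \in polyalg phi -> B \in polyalg phi -> A *m B = B *m A.
Proof.
by move=> /polyalgP[p ->] /polyalgP[q ->]; apply: comm_horner_mx2.
Qed.

Fact semidirect_jacobi g h k :
  semidirect_bracket g (semidirect_bracket h k)
    + semidirect_bracket h (semidirect_bracket k g)
    + semidirect_bracket k (semidirect_bracket g h) = 0.
Proof.
case: g h k => [g x] [h y] [k z]; congr (_, _); first by rewrite /= !addr0.
rewrite /= !mul0mx !subr0 !mulmxBr !mulmxA.
rewrite (polyalg_mulC (subvsP h) (subvsP g)) (polyalg_mulC (subvsP k) (subvsP g)).
rewrite (polyalg_mulC (subvsP k) (subvsP h)).
by apply/matrixP=> i j; rewrite !mxE; ring.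
Qed.

HB.instance Definition _ := isLieAlgebra.Build K (semidirect phi)
  semidirect_linearl semidirect_linearr semidirect_bracketxx
  semidirect_jacobi.

End Semidirect.

(* aff(K): coordinates x 0 0, x 0 1 in a basis e_1, e_2 with                  *)
(* [e_1, e_2] = e_2.                                                          *)
Definition affR (K : fieldType) : Type := 'rV[K]_2.

Section AffR.
Context (K : fieldType).

HB.instance Definition _ := Vector.copy (affR K) 'rV[K]_2.

Implicit Types (x y z : affR K).

Definition affR_bracket x y : affR K :=
  \row_j [:: 0; x 0 0 * y 0 1 - x 0 1 * y 0 0]`_j.

Ltac affR_tac :=
  apply/rowP; case=> -[|[|//]] ?; rewrite !mxE /=; ring.

Fact affR_linearl (a : K) x y z :
  affR_bracket (a *: x + y) z = a *: affR_bracket x z + affR_bracket y z.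
Proof. affR_tac. Qed.

Fact affR_linearr (a : K) x y z :
  affR_bracket z (a *: x + y) = a *: affR_bracket z x + affR_bracket z y.
Proof. affR_tac. Qed.

Fact affR_bracketxx x : affR_bracket x x = 0.
Proof. affR_tac. Qed.

Fact affR_jacobi x y z :
  affR_bracket x (affR_bracket y z) + affR_bracket y (affR_bracket z x)
    + affR_bracket z (affR_bracket x y) = 0.
Proof. affR_tac. Qed.

HB.instance Definition _ := isLieAlgebra.Build K (affR K)
  affR_linearl affR_linearr affR_bracketxx affR_jacobi.

Lemma affR_table (e := fun i : 'I_2 => delta_mx 0 i : affR K) :
  bracket (e 0) (e 1) = e 1.
Proof. by apply/rowP; case=> -[|[|//]] ?; rewrite !mxE /=; ring. Qed.

End AffR.

(* aff(C) over the base field K (meant for K real): the table is affC_table.  *)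
Definition affC (K : fieldType) : Type := 'rV[K]_4.

Section AffC.
Context (K : fieldType).

HB.instance Definition _ := Vector.copy (affC K) 'rV[K]_4.

Implicit Types (x y z : affC K).

Definition affC_bracket x y : affC K :=
  \row_j [:: 0; 0;
    (x 0 0 * y 0 2 - x 0 2 * y 0 0) - (x 0 1 * y 0 3 - x 0 3 * y 0 1);
    (x 0 0 * y 0 3 - x 0 3 * y 0 0) + (x 0 1 * y 0 2 - x 0 2 * y 0 1)]`_j.

Ltac affC_tac :=
  apply/rowP; case=> -[|[|[|[|//]]]] ?; rewrite !mxE /=; ring.

Fact affC_linearl (a : K) x y z :
  affC_bracket (a *: x + y) z = a *: affC_bracket x z + affC_bracket y z.
Proof. affC_tac. Qed.

Fact affC_linearr (a : K) x y z :
  affC_bracket z (a *: x + y) = a *: affC_bracket z x + affC_bracket z y.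
Proof. affC_tac. Qed.

Fact affC_bracketxx x : affC_bracket x x = 0.
Proof. affC_tac. Qed.

Fact affC_jacobi x y z :
  affC_bracket x (affC_bracket y z) + affC_bracket y (affC_bracket z x)
    + affC_bracket z (affC_bracket x y) = 0.
Proof. affC_tac. Qed.

HB.instance Definition _ := isLieAlgebra.Build K (affC K)
  affC_linearl affC_linearr affC_bracketxx affC_jacobi.

Lemma affC_table (e := fun i : 'I_4 => delta_mx 0 i : affC K) :
  (bracket (e 0) (e 2) = e 2) * (bracket (e 0) (e 3) = e 3) *
  (bracket (e 1) (e 2) = e 3) * (bracket (e 1) (e 3) = - e 2) *
  (bracket (e 0) (e 1) = 0) * (bracket (e 2) (e 3) = 0).
Proof.
by do !split; apply/rowP; case=> -[|[|[|[|//]]]] ?; rewrite !mxE /=; ring.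
Qed.

End AffC.

Section DirectSum.
Context (K : fieldType) (L M : lieAlgType K).

Definition pair_bracket (x y : (L * M)%type) : (L * M)%type :=
  (bracket x.1 y.1, bracket x.2 y.2).

Fact pair_linearl (a : K) (x y z : (L * M)%type) :
  pair_bracket (a *: x + y) z = a *: pair_bracket x z + pair_bracket y z.
Proof. by congr (_, _); rewrite /= bracket_linearl. Qed.

Fact pair_linearr (a : K) (x y z : (L * M)%type) :
  pair_bracket z (a *: x + y) = a *: pair_bracket z x + pair_bracket z y.
Proof. by congr (_, _); rewrite /= bracket_linearr. Qed.

Fact pair_bracketxx (x : (L * M)%type) : pair_bracket x x = 0.
Proof. by congr (_, _); rewrite /= bracketxx. Qed.

Fact pair_jacobi (x y z : (L * M)%type) :
  pair_bracket x (pair_bracket y z) + pair_bracket y (pair_bracket z x)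
    + pair_bracket z (pair_bracket x y) = 0.
Proof. by congr (_, _); rewrite /= bracket_jacobi. Qed.

HB.instance Definition _ := isLieAlgebra.Build K (L * M)%type
  pair_linearl pair_linearr pair_bracketxx pair_jacobi.

End DirectSum.

Section DirectPower.
Context (K : fieldType) (I : finType) (L : lieAlgType K).
Implicit Types (x y z : {ffun I -> L}).

Definition ffun_bracket x y : {ffun I -> L} := [ffun i => bracket (x i) (y i)].

Fact ffun_linearl (a : K) x y z :
  ffun_bracket (a *: x + y) z = a *: ffun_bracket x z + ffun_bracket y z.
Proof. by apply/ffunP=> i; rewrite !ffunE bracket_linearl. Qed.

Fact ffun_linearr (a : K) x y z :
  ffun_bracket z (a *: x + y) = a *: ffun_bracket z x + ffun_bracket z y.
Proof. by apply/ffunP=> i; rewrite !ffunE bracket_linearr. Qed.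

Fact ffun_bracketxx x : ffun_bracket x x = 0.
Proof. by apply/ffunP=> i; rewrite !ffunE bracketxx. Qed.

Fact ffun_jacobi x y z :
  ffun_bracket x (ffun_bracket y z) + ffun_bracket y (ffun_bracket z x)
    + ffun_bracket z (ffun_bracket x y) = 0.
Proof. by apply/ffunP=> i; rewrite !ffunE bracket_jacobi. Qed.

HB.instance Definition _ := isLieAlgebra.Build K {ffun I -> L}
  ffun_linearl ffun_linearr ffun_bracketxx ffun_jacobi.

End DirectPower.

Definition nonderogatory (K : fieldType) (n : nat) (phi : 'M[K]_n.+1) : Prop :=
  char_poly phi = mxminpoly phi.

(* n.+1 is the size of phi. mathcomp's eigenvalue is about row vectors, which *)
(* over a field makes no difference.                                          *)
Definition distinct_eigenvalues (R : rcfType) (n : nat) (phi : 'M[R]_n.+1) :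
    Prop :=
  exists s : seq (complex R),
    [/\ uniq s, size s = n.+1 &
        forall a, a \in s -> eigenvalue (map_mx (real_complex R) phi) a].

(* Main.v *)
From HB Require Import structures.
Require Import Defs.
From mathcomp Require Import all_boot all_order all_algebra all_field.
From mathcomp Require Import reals.
From mathcomp Require Import complex polyorder ring.

(* Write A for the algebra R[phi]. Both (1) and (2) say that every T with
   [T, A] <= A lies in A: such a T extends to the derivation
   (a, x) |-> ([T, a], T x), and every derivation is of this form up to an
   inner one, because the identity matrix of A acts as the identity on R^n.
   The other conditions pass through the reducedness of A:
   - if b in A has square 0, then b C has trace 0 for all C commuting with
     phi, so b = [T, phi] for some T; T normalizes A, hence b = 0 under (2);
   - if b in A has square 0, then R b + R^n is a nilpotent ideal, which is
     Abelian only if b = 0; conversely, if A is reduced, R^n is the largest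
     nilpotent ideal;
   - in sums of copies of aff(R) and aff(C), (ad x)^3 = 0 implies
     (ad x)^2 = 0, which fails for x = (b, v) if b^2 = 0 and b v <> 0;
   - if phi is nonderogatory, A is R[X] modulo the characteristic polynomial,
     so A is reduced only if this polynomial is separable.
   Distinct eigenvalues give a basis of eigenvectors u_l over C. In it the
   elements of A are diagonal, so A is reduced; comparing diagonal entries, T
   is diagonal if [T, phi] is in A, hence in A by interpolation. The pairs
   (a, x) |-> (c_l(a), u_l x), where u_l a = c_l(a) u_l, give the
   decomposition (5), one copy of aff(R) for each real l and one copy of
   aff(C) for each l with positive imaginary part. *)

Set Implicit Arguments.
Unset Strict Implicit.
Unset Printing Implicit Defensive.

Import Order.TTheory GRing.Theory Num.Theory.
Local Open Scope ring_scope.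

(** * Matrices as operators on column vectors *)

Lemma eq_mulmx_cV (K : fieldType) m n (A B : 'M[K]_(m, n)) :
  (forall x : 'cV_n, A *m x = B *m x) -> A = B.
Proof.
move=> eqAB; apply/matrixP=> i j.
by have /colP/(_ i) := eqAB (delta_mx j 0); rewrite -!colE !mxE.
Qed.

Lemma linear_cV_mx (K : fieldType) m n (f : 'cV[K]_n -> 'cV[K]_m) :
  linear f -> exists T : 'M_(m, n), forall x, f x = T *m x.
Proof.
(* [lin1_mx] represents maps of row vectors, hence the transposes. *)
move=> linf; pose g (u : 'rV_n) := (f u^T)^T.
have ling : linear g by move=> a u v; rewrite /g linearP linf linearP.
pose gL := GRing.isLinear.Build K _ _ _ g ling.
pose G : {linear _ -> _} := HB.pack g gL.
exists (lin1_mx G)^T => x.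
by rewrite -[x in RHS]trmxK -trmx_mul mul_rV_lin1 /= /g !trmxK.
Qed.

(** * The algebra [A] and its normalizer *)

Section Field.
Context (K : fieldType) (n : nat) (phi : 'M[K]_n.+1).
Local Notation A := (polyalg phi).
Local Notation G := (semidirect phi).

Lemma semidirectE (g h : G) :
  bracket g h = (0, vsval g.1 *m h.2 - vsval h.1 *m g.2) :> G.
Proof. by []. Qed.

Lemma one_polyalg : 1%:M \in A.
Proof. by apply/polyalgP; exists 1; rewrite [RHS]rmorph1. Qed.

Lemma phi_polyalg : phi \in A.
Proof. exact: memv_adjoin. Qed.

Lemma mulmx_polyalg a b : a \in A -> b \in A -> a *m b \in A.
Proof.
by move=> /polyalgP[p ->] /polyalgP[q ->]; apply/polyalgP; exists (p * q);
  rewrite rmorphM.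
Qed.

Lemma polyalg_comm a c : a \in A -> comm_mx phi c -> comm_mx a c.
Proof. by move=> /polyalgP[p ->] /comm_horner_mx; apply. Qed.

(** [bracket T] obeys the Leibniz rule for the matrix product, so membership in [A] passes from
    [phi] to all polynomials in [phi]. *)
Lemma polyalg_normalizer (T : 'M_n.+1) :
  bracket T phi \in A -> in_normalizer A T.
Proof.
move=> Tphi _ /polyalgP[p ->].
elim/poly_ind: p => [|p c IHp].
  by rewrite rmorph0 /bracket /= /gl_bracket mulmx0 mul0mx subr0 mem0v.
have pA : horner_mx phi p \in A by apply/polyalgP; exists p.
rewrite rmorphD rmorphM /= horner_mx_X horner_mx_C.
rewrite /bracket /= /gl_bracket in IHp Tphi *.
rewrite -mulmxE mulmxDl mulmxDr scalar_mxC.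
rewrite opprD addrACA subrr addr0 !mulmxA.
have -> : T *m horner_mx phi p *m phi - horner_mx phi p *m phi *m T =
  (T *m horner_mx phi p - horner_mx phi p *m T) *m phi +
  horner_mx phi p *m (T *m phi - phi *m T).
  by rewrite mulmxBl mulmxBr !mulmxA subrKA.
by rewrite memvD // mulmx_polyalg ?phi_polyalg.
Qed.

(** * Derivations of the semidirect product *)

(** [vsproj] makes the map total and linear for every [T]; it leaves the bracket unchanged when [T]
    normalizes [A]. *)
Definition normalizer_map (T : 'M[K]_n.+1) (g : G) : G :=
  (vsproj A (bracket T (vsval g.1)), T *m g.2).

Lemma normalizer_map_linear T : linear (normalizer_map T).
Proof.
move=> a [g x] [h y]; congr (_, _) => /=.
  have E : vsval (a *: g + h) = a *: vsval g + vsval h by exact: linearP.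
  rewrite [X in bracket T X]E.
  by rewrite bracket_linearr linearP.
by rewrite mulmxDr -scalemxAr.
Qed.

HB.instance Definition _ T :=
  GRing.isLinear.Build K G G _ (normalizer_map T) (normalizer_map_linear T).

Lemma normalizer_derivation T :
  in_normalizer A T -> derivation (linfun (normalizer_map T)).
Proof.
move=> nT [g x] [h y]; rewrite !lfunE /=; congr (_, _) => /=.
  by rewrite addr0 /bracket /= /gl_bracket mulmx0 mul0mx subr0 linear0.
rewrite !vsprojK ?nT ?subvsP // /bracket /= /gl_bracket.
rewrite !mulmxBl !mulmxBr !mulmxA.
apply/matrixP=> i j; rewrite !mxE; ring.
Qed.

Lemma normalizer_cartan :
  (forall T, in_normalizer A T -> T \in A) -> cartan_subalgebra A.
Proof.
have cA a b : a \in A -> b \in A -> bracket a b = 0.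
  by move=> aA bA; rewrite /bracket /= /gl_bracket (polyalg_mulC aA bA) subrr.
move=> nA; split=> [a b aA bA | | T]; first by rewrite (cA _ _ aA bA) mem0v.
  exists 1%N; apply/eqP; rewrite -subv0; apply/bracketv_leP => a b aA bA.
  by rewrite (cA _ _ aA bA) mem0v.
split=> [TA b bA | /nA//].
  by rewrite (cA _ _ TA bA) mem0v.
Qed.

(** If the derivation extending [T] is the bracket with (a, x), comparing both on column vectors
    gives T = a. *)
Lemma complete_cartan :
  (forall D : 'End(G), derivation D -> inner_derivation D) ->
  cartan_subalgebra A.
Proof.
move=> innerD; apply: normalizer_cartan => T.
move=> /normalizer_derivation/innerD [[a x] Da].
suff -> : T = vsval a by apply: subvsP.
apply: eq_mulmx_cV => w.
by have := Da (0, w); rewrite lfunE => -[_] /=; rewrite mul0mx subr0.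
Qed.

Lemma cartan_complete : cartan_subalgebra A ->
  forall D : 'End(G), derivation D -> inner_derivation D.
Proof.
move=> [_ _ cA] D derD.
(* [e] commutes with the copy of [A] and acts as the identity on column vectors; applying [D] to
   brackets with [e] separates the components of [D]. *)
pose e : G := (vsproj A 1%:M, 0); pose y := (D e).2.
have e1 : vsval e.1 = 1%:M by rewrite vsprojK ?one_polyalg.
have [T DT] : exists T : 'M_n.+1, forall x, (D (0, x)).2 = T *m x.
  apply: linear_cV_mx => a x z.
  have -> : (0, a *: x + z) = a *: (0, x) + (0, z) :> G.
    by congr (_, _); rewrite /= ?scaler0 ?addr0.
  by rewrite linearP.
(* (0, x) = [e, (0, x)], so its image is a sum of brackets, whose first components are 0. *)
have D0 x : (D (0, x)).1 = 0.
  have := derD e (0, x); rewrite !semidirectE /=.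
  rewrite e1 mul1mx mul0mx subr0 => ->; exact: addr0.
have Da2 a : (D (a, 0)).2 = vsval a *m y.
  have := derD e (a, 0); rewrite !semidirectE /=.
  rewrite mulmx0 mulmx0 subrr linear0 => /(congr1 snd) /=.
  rewrite mulmx0 sub0r mulmx0 subr0 e1 mul1mx => /esym/eqP.
  by rewrite addrC subr_eq0 => /eqP.
(* Apply [D] to [(a, 0), (0, x)] = (0, a x). *)
have Da1 a : vsval (D (a, 0)).1 = bracket T (vsval a).
  apply: eq_mulmx_cV => x.
  have := derD (a, 0) (0, x); rewrite !semidirectE /=.
  rewrite mul0mx subr0 => /(congr1 snd); rewrite DT /= D0 DT.
  rewrite mul0mx !subr0 mulmxBl !mulmxA => ->.
  by rewrite mul0mx subr0 addrK.
have TA : T \in A.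
  apply/cA => a aA; rewrite -[a](vsprojK aA) -Da1; exact: subvsP.
(* Since T is in [A], [T, a] = 0 and D(a, x) = (0, T x + a y), which is the bracket of (T, - y) with
   (a, x). *)
exists (vsproj A T, - y) => -[a x].
have -> : (a, x) = (a, 0) + (0, x) :> G.
  by congr (_, _); rewrite /= ?addr0 ?add0r.
rewrite linearD [LHS]surjective_pairing /=.
rewrite D0 addr0 Da2 DT semidirectE /= vsprojK // add0r addr0; congr (_, _).
  apply/val_inj; rewrite /= Da1 /bracket /= /gl_bracket.
  by rewrite (polyalg_mulC TA (subvsP a)) subrr.
by rewrite mulmxN opprK addrC.
Qed.

(** * Reducedness and the trace form *)

Definition reduced_polyalg := forall b, b \in A -> b *m b = 0 -> b = 0.

(** Write M = C R with C of full column rank and R of full row rank: C R C R = 0 forces R C = 0, and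
    M and R C have the same trace. *)
Lemma mxtrace_sqr0 m (M : 'M[K]_m) : M *m M = 0 -> \tr M = 0.
Proof.
rewrite -(mulmx_base M); set C := col_base M; set R := row_base M => MM.
rewrite mxtrace_mulC; suff -> : R *m C = 0 by rewrite mxtrace0.
have RR : row_free R := row_base_free M.
have CC : row_full C := col_base_full M.
apply: (row_free_inj RR); apply: (row_full_inj CC).
by rewrite mul0mx mulmx0 -MM !mulmxA.
Qed.

(** A column of length m^2 is a linear functional on matrices; the right side represents it by the
    trace form. *)
Lemma mul_mxvec_trace m (M : 'M[K]_m) (c : 'cV_(m * m)) :
  mxvec M *m c = (\tr (M *m (vec_mx c^T)^T))%:M.
Proof.
apply/matrixP=> i j; rewrite !ord1 !mxE eqxx mulr1n.
rewrite (reindex _ (curry_mxvec_bij _ _)) /=.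
under [RHS]eq_bigr do rewrite mxE.
rewrite pair_bigA; apply: eq_bigr => -[k l] _ /=.
by rewrite mxvecE !mxE.
Qed.

(** The trace form is nondegenerate: matrix units read off the entries. *)
Lemma mxtrace_mul_eq0 m (M : 'M[K]_m) :
  (forall N, \tr (N *m M) = 0) -> M = 0.
Proof.
move=> trM; apply/matrixP=> i j; have := trM (delta_mx j i).
rewrite mxE /mxtrace (bigD1 j) //= big1 => [|k kj]; last first.
  by rewrite mxE big1 // => l _; rewrite mxE (negPf kj) mul0r.
rewrite addr0 mxE (bigD1 i) //= big1 => [|k ki]; last first.
  by rewrite mxE (negPf ki) andbF mul0r.
by rewrite mxE !eqxx mul1r addr0.
Qed.

(* The image of [ad phi] is the orthogonal of the centralizer of [phi] for the
   trace form. *)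
Lemma bracket_image (b : 'M[K]_n.+1) :
  (forall C, comm_mx phi C -> \tr (b *m C) = 0) -> exists T, bracket T phi = b.
Proof.
move=> trb; pose F := lin_mx (bracketr phi).
have [/submxP[u bF] | nbF] := boolP (mxvec b <= F)%MS.
  by exists (vec_mx u); apply: (can_inj mxvecK); rewrite bF mul_rV_lin.
have /eqP[] : mxvec b *m cokermx F != 0 by rewrite -submxE.
have colM m (B : 'M_(m, _)) k :
    col k (B *m cokermx F) = B *m col k (cokermx F).
  by rewrite !colE mulmxA.
(* A column of [cokermx F] is a functional vanishing on the image; its matrix [C] for the trace form
   satisfies tr(M [phi, C]) = 0 for all M, so it commutes with [phi] and the functional kills b. *)
apply: (can_inj trmxK); apply/row_matrixP => k.
rewrite -!tr_col colM; set c := col k _; congr (_^T).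
rewrite mul_mxvec_trace trb; first by apply/matrixP=> i j; rewrite !mxE mul0rn.
set C := (_^T); have FC M : \tr (bracket M phi *m C) = 0.
  have : mxvec M *m F *m c = 0.
    by rewrite -mulmxA -colM mulmx_coker col0 mulmx0.
  rewrite mul_vec_lin mul_mxvec_trace => /matrixP/(_ 0 0).
  by rewrite !mxE mulr1n.
apply/eqP; rewrite -subr_eq0; apply/eqP/mxtrace_mul_eq0 => M.
rewrite -[RHS](FC M) /bracket /= /gl_bracket mulmxBr mulmxBl !mulmxA !linearB.
by congr (_ - _); rewrite /= mxtrace_mulC mulmxA.
Qed.

Lemma cartan_reduced : cartan_subalgebra A -> reduced_polyalg.
Proof.
move=> [_ _ cA] b bA bb; have [|T Tb] := @bracket_image b.
  (* b commutes with [C], so (b C)^2 = b^2 C^2 = 0. *)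
  move=> C Cphi; apply: mxtrace_sqr0.
  have bC : b *m C = C *m b by apply: polyalg_comm.
  by rewrite mulmxA -[b *m C *m b]mulmxA -bC mulmxA bb !mul0mx.
have TA : T \in A by apply/cA/polyalg_normalizer; rewrite Tb.
by rewrite -Tb /bracket /= /gl_bracket (polyalg_mulC TA phi_polyalg) subrr.
Qed.

(** * Reducedness and the nilradical *)

Lemma nilradical_reduced :
  (exists N : {vspace G}, is_nilradical N /\ lie_abelian N) -> reduced_polyalg.
Proof.
move=> [N [[_ _ maxN] abN]] b bA bb.
pose pr := linfun (fst : G -> subvs_of A).
(* The multiples of b together with all column vectors. *)
pose I := (pr @^-1: <[vsproj A b]>)%VS.
have I_P g : g \in I -> exists k, vsval g.1 = k *: b.
  rewrite -memv_preim lfunE /= => /vlineP[k ->].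
  by exists k; rewrite linearZ /= vsprojK.
have VI x : (0, x) \in I by rewrite -memv_preim lfunE mem0v.
have bI : (vsproj A b, 0) \in I by rewrite -memv_preim lfunE memv_line.
have idI : lie_ideal I by move=> g h _; rewrite semidirectE VI.
have nilI : lie_nilpotent I.
  pose pr2 := linfun (snd : G -> 'cV_n.+1).
  (* [J] consists of the column vectors killed by b; [I, I] lies in [J] since b^2 = 0, and [I, J] =
     0. *)
  pose J := (lker pr :&: lker (linfun (mulmx b) \o pr2))%VS.
  have JP g : g \in J = (g.1 == 0) && (b *m g.2 == 0).
    by rewrite memv_cap !memv_ker comp_lfunE !lfunE.
  have II : (bracketv I I <= J)%VS.
    apply/bracketv_leP => g h /I_P[k gb] /I_P[l hb].
    rewrite semidirectE JP /= eqxx mulmxBr gb hb -!scalemxAl -!scalemxAr.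
    by rewrite !mulmxA bb !mul0mx !scaler0 subrr eqxx.
  exists 2; apply/eqP; rewrite -subv0; apply/bracketv_leP => g h /I_P[k gb].
  move=> /(subvP II); rewrite JP => /andP[/eqP h1 /eqP h2].
  by rewrite semidirectE h1 gb mul0mx subr0 -scalemxAl h2 scaler0 mem0v.
have IN := subvP (maxN I idI nilI).
apply: eq_mulmx_cV => x; have := abN _ _ (IN _ bI) (IN _ (VI x)).
by rewrite semidirectE /= vsprojK // !mul0mx subr0 => -[].
Qed.

Lemma expr_polyalg a k : a \in A -> a ^+ k \in A.
Proof.
by case/polyalgP=> p ->; apply/polyalgP; exists (p ^+ k); rewrite rmorphXn.
Qed.

Lemma reduced_nilpotent a k :
  reduced_polyalg -> a \in A -> a ^+ k = 0 -> a = 0.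
Proof.
move=> red aA; elim: k => [/eqP|[|k] IHk aX0]; first by rewrite expr0 oner_eq0.
  exact: aX0.
(* The square of a^(k+1) is a^(k+2) a^k = 0. *)
apply: IHk; apply: red (expr_polyalg _ aA) _.
by rewrite mulmxE -exprD addSnnS addnC exprD aX0 mul0r.
Qed.

Lemma reduced_nilradical :
  reduced_polyalg -> exists N : {vspace G}, is_nilradical N /\ lie_abelian N.
Proof.
move=> red; pose pr := linfun (fst : G -> subvs_of A).
have VP g : g \in lker pr = (g.1 == 0) by rewrite memv_ker lfunE.
have abV : lie_abelian (lker pr).
  move=> g h; rewrite !VP semidirectE => /eqP-> /eqP->.
  by rewrite !mul0mx subrr.
exists (lker pr); split=> //; split=> [g h _ | | I idI [k nilI]].
- by rewrite semidirectE VP.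
- exists 1%N; apply/eqP; rewrite -subv0; apply/bracketv_leP => g h gV hV.
  by rewrite abV ?mem0v.
apply/subvP => -[a x] aI; rewrite VP /=.
(* Each bracket with (a, x) multiplies a column vector by a. The ideal property already gives one
   factor at [l] = 0, so nilpotency of [I] makes a nilpotent. *)
have lcI l y : (0, vsval a ^+ l.+1 *m y) \in lower_central I l.
  elim: l => [|l IHl].
    have := idI (0, - y) _ aI.
    by rewrite semidirectE /= mul0mx sub0r mulmxN opprK expr1.
  have /bracketv_leP/(_ _ _ aI IHl) := subvv (bracketv I (lower_central I l)).
  by rewrite semidirectE /= mul0mx subr0 mulmxA [_ ^+ l.+2]exprS.
apply/eqP/val_inj/(reduced_nilpotent red (k := k.+1) (subvsP a)).
apply: eq_mulmx_cV => y; have := lcI k y.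
by rewrite nilI memv0 mul0mx => /eqP[].
Qed.

End Field.

(** * Separability of the minimal polynomial *)

Lemma reduced_distinct (R : rcfType) n (phi : 'M[R]_n.+1) :
  nonderogatory phi -> reduced_polyalg phi -> distinct_eigenvalues phi.
Proof.
move=> ndphi red; pose p := mxminpoly phi.
have p0 : p != 0 by rewrite monic_neq0 ?mxminpoly_monic.
have sep_p : separable_poly p.
  (* In characteristic 0 it suffices that p is square-free. If p = w u^2, then (w u)^2 = w p kills
     [phi], so reducedness gives (w u)(phi) = 0 and p divides w u: u is constant. *)
  apply/separable_polyP; split=> [|u _ u1]; last first.
    by rewrite -size_poly_gt0 size_deriv -subn1 subn_gt0.
  apply/poly_square_freeP => u u1; apply/negP => /dvdpP[w pwu].
  have wu0 : w * u != 0.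
    by apply: contraNneq p0 => wu0; rewrite pwu expr2 mulrA wu0 mul0r.
  have u0 : u != 0 by apply: contraNneq wu0 => ->; rewrite mulr0.
  have : horner_mx phi (w * u) = 0.
    apply: red; first by apply/polyalgP; exists (w * u).
    have wuwu : w * u * (w * u) = w * p by rewrite pwu; ring.
    by rewrite mulmxE -rmorphM /= wuwu rmorphM /= mx_root_minpoly mulr0.
  move/mxminpoly_min/dvdp_leq => /(_ wu0); rewrite -/p pwu expr2 mulrA.
  rewrite size_mul // -subn1 leq_subLR add1n => leS.
  have u_le1 : (size u <= 1)%N by rewrite -(leq_add2l (size (w * u))) addn1.
  by move: u1; rewrite eqn_leq u_le1 size_poly_gt0 u0.
have [s sP] := closed_field_poly_normal (map_poly (real_complex R) p).
move: sP; rewrite lead_coef_map (monicP (mxminpoly_monic phi)) rmorph1.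
rewrite scale1r => sP.
exists s; split.
- by rewrite -separable_prod_XsubC -sP separable_map.
(* The minimal polynomial has degree [n.+1], being the characteristic polynomial. *)
- apply: succn_inj; rewrite -(size_prod_XsubC s id) -sP size_map_poly.
  by rewrite /p -ndphi size_char_poly.
- move=> a sa.
  by rewrite eigenvalue_root_min mxminpoly_map -/p sP root_prod_XsubC.
Qed.

(** * Bases of eigenvectors *)

Lemma horner_mx_eigen (K : fieldType) n (phi : 'M[K]_n.+1) (u : 'rV_n.+1) l p :
  u *m phi = l *: u -> u *m horner_mx phi p = p.[l] *: u.
Proof.
move=> uphi; elim/poly_ind: p => [|p c IHp].
  by rewrite rmorph0 mulmx0 horner0 scale0r.
rewrite rmorphD rmorphM /= horner_mx_X horner_mx_C mulmxDr mulmxA IHp.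
rewrite -scalemxAl uphi scalerA mul_mx_scalar -scalerDl.
by rewrite hornerE hornerMX hornerC.
Qed.

(** Lagrange interpolation: among the nodes, [q i] is nonzero only at [lam i]. *)
Lemma interpolation (K : fieldType) n (lam v : 'I_n -> K) :
  injective lam -> exists p : {poly K}, forall i, p.[lam i] = v i.
Proof.
move=> inj_lam; pose q i := \prod_(j | j != i) ('X - (lam j)%:P).
have qE i j : (q i).[lam j] != 0 = (i == j).
  rewrite horner_prod; under eq_bigr do rewrite hornerXsubC.
  apply/prodf_neq0/eqP => [q0 | <- k ki].
    apply/eqP/negPn/negP => ij; have := q0 j; rewrite eq_sym ij subrr eqxx.
    by move=> /(_ isT).
  by rewrite subr_eq0 (inj_eq inj_lam) eq_sym.
exists (\sum_i (v i / (q i).[lam i]) *: q i) => i.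
rewrite horner_sum (bigD1 i) //= big1 => [|j ji].
  by rewrite hornerZ divfK ?addr0 // qE.
by rewrite hornerZ (eqP (negbFE (etrans (qE _ _) (negPf ji)))) mulr0.
Qed.

(** In a vanishing combination of the rows, the polynomial that is 1 at [lam i] and 0 at the other
    eigenvalues, evaluated at [phi], isolates the i-th term. *)
Lemma eigenbasis_unit (K : fieldType) n (phi : 'M[K]_n.+1)
    (lam : 'I_n.+1 -> K) (U : 'M[K]_n.+1) :
  injective lam -> (forall i, row i U != 0) ->
  (forall i, row i U *m phi = lam i *: row i U) -> U \in unitmx.
Proof.
move=> inj_lam U0 eigU; rewrite -row_free_unit; apply: inj_row_free => v vU.
apply/rowP => i; rewrite mxE; apply/eqP.
have [p pE] := interpolation (fun j => (i == j)%:R) inj_lam.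
have : v *m U *m horner_mx phi p = 0 by rewrite vU mul0mx.
rewrite [v *m U]mulmx_sum_row mulmx_suml (bigD1 i) //= big1 => [|j ji].
  rewrite addr0 -scalemxAl (horner_mx_eigen _ (eigU i)) pE eqxx scale1r.
  by move/eqP; rewrite scaler_eq0 (negPf (U0 i)) orbF.
rewrite -scalemxAl (horner_mx_eigen _ (eigU j)) pE eq_sym (negPf ji).
by rewrite scale0r scaler0.
Qed.

Lemma row_diag_mul (K : fieldType) m n (d : 'rV[K]_m) (A : 'M_(m, n)) i :
  row i (diag_mx d *m A) = d 0 i *: row i A.
Proof. by apply/rowP => j; rewrite mul_diag_mx !mxE. Qed.

(** * Consequences of distinct eigenvalues *)

Section Distinct.
Context (R : rcfType) (n : nat) (phi : 'M[R]_n.+1).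
Local Notation C := (complex R).
Local Notation "M ^C" := (map_mx (real_complex R) M).

Lemma distinct_eigenbasis : distinct_eigenvalues phi ->
  exists (lam : 'I_n.+1 -> C) (U : 'M[C]_n.+1),
    [/\ injective lam, U \in unitmx &
        forall i, row i U *m phi^C = lam i *: row i U].
Proof.
move=> [s [uniq_s size_s eig_s]].
pose lam (i : 'I_n.+1) := s`_i.
have inj_lam : injective lam.
  by move=> i j /eqP; rewrite nth_uniq ?size_s // => /eqP/val_inj.
pose U := \matrix_i nz_row (eigenspace phi^C (lam i)).
have UE i : row i U = nz_row (eigenspace phi^C (lam i)) by rewrite rowK.
have eigU i : row i U *m phi^C = lam i *: row i U.
  by apply/eigenspaceP; rewrite UE nz_row_sub.
exists lam, U; split=> //; apply: eigenbasis_unit eigU => // i.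
by rewrite UE nz_row_eq0; apply/eig_s/mem_nth; rewrite size_s.
Qed.

Lemma distinct_reduced : distinct_eigenvalues phi -> reduced_polyalg phi.
Proof.
case/distinct_eigenbasis => lam [U [_ unitU eigU]] _ /polyalgP[p ->] pp0.
apply: (map_mx_inj (f := real_complex R)); rewrite map_mx0 map_horner_mx.
set q := map_poly _ p; apply: (can_inj (mulKmx unitU)); rewrite mulmx0.
apply/row_matrixP => i; rewrite row_mul row0 (horner_mx_eigen _ (eigU i)).
have : row i U *m (horner_mx phi p *m horner_mx phi p)^C = 0.
  by rewrite pp0 map_mx0 mulmx0.
rewrite map_mxM map_horner_mx -/q mulmxA.
rewrite !(horner_mx_eigen _ (eigU i), =^~ scalemxAl).
by rewrite scalerA => /eqP; rewrite scaler_eq0 mulf_eq0 orbb => /orP[]/eqP->;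
  rewrite ?scale0r ?scaler0.
Qed.

(** Lying in the span of the powers of [phi] is a rank condition, hence insensitive to extension of
    the field. *)
Lemma map_polyalg (T : 'M[R]_n.+1) (p : {poly C}) :
  T^C = horner_mx phi^C p -> T \in polyalg phi.
Proof.
move=> TE; have := horner_mx_mem phi^C p; rewrite -TE degree_mxminpoly_map.
rewrite -map_powers_mx -map_mxvec map_submx => /mx_inv_hornerK <-.
by apply/polyalgP; eexists.
Qed.

Lemma distinct_cartan :
  distinct_eigenvalues phi -> cartan_subalgebra (polyalg phi).
Proof.
case/distinct_eigenbasis => lam [U [inj_lam unitU eigU]].
pose D := diag_mx (\row_i lam i).
have UD : U *m phi^C = D *m U.
  by apply/row_matrixP => i; rewrite row_mul eigU row_diag_mul mxE.
apply: normalizer_cartan => T nT.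
have /polyalgP[g gE] := nT _ (phi_polyalg phi).
set h := map_poly (real_complex R) g.
(* [T'] is the matrix of T in the eigenbasis; there [phi] becomes [D] and [T, phi] = g(phi) becomes
   diagonal. *)
have [T' UT] : exists T', U *m T^C = T' *m U.
  by exists (U *m T^C *m invmx U); rewrite mulmxKV.
have T'D : T' *m D - D *m T' = diag_mx (\row_i h.[lam i]).
  apply: (can_inj (mulmxK unitU)); rewrite mulmxBl -!mulmxA -UD -UT !mulmxA -UD.
  rewrite -UT -!mulmxA -mulmxBr -!map_mxM -map_mxB.
  rewrite -[_ - _]/(bracket T phi) gE map_horner_mx.
  apply/row_matrixP => i; rewrite row_diag_mul mxE row_mul.
  exact: horner_mx_eigen (eigU i).
(* Off the diagonal the right side is 0 and the eigenvalues differ, so [T'] is diagonal. *)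
have T'E i j : T' i j * (lam j - lam i) = h.[lam i] *+ (i == j).
  have /matrixP/(_ i j) := T'D.
  by rewrite mul_mx_diag mul_diag_mx !mxE => <-; ring.
(* Interpolating the diagonal of [T'] at the eigenvalues exhibits T as a complex polynomial in
   [phi]. *)
have [p pE] := interpolation (fun i => T' i i) inj_lam.
apply: (@map_polyalg _ p); apply: (can_inj (mulKmx unitU)).
rewrite UT; apply/row_matrixP => i.
rewrite !row_mul (horner_mx_eigen _ (eigU i)).
rewrite pE; have -> : row i T' = T' i i *: delta_mx 0 i.
  apply/rowP => j; rewrite !mxE eqxx /=; have [<-|ji] := eqVneq i j.
    by rewrite mulr1.
  apply/eqP; rewrite mulr0 -(mulIr_eq0 _ (mulIf (x := lam j - lam i) _)).
    by rewrite T'E (negPf ji).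
  by rewrite subr_eq0 (inj_eq inj_lam) eq_sym.
by rewrite -scalemxAl -rowE.
Qed.
End Distinct.

(** * Elements with nilpotent adjoint action *)

(** This property is invariant under isomorphism and passes to direct sums, so for (5) it need only
    be checked on aff(R) and aff(C). *)
Definition ad_nil_sqr0 (K : fieldType) (L : lieAlgType K) : Prop :=
  forall x : L, (forall y, bracket x (bracket x (bracket x y)) = 0) ->
  forall y, bracket x (bracket x y) = 0.

Lemma ad_nil_sqr0_iso (K : fieldType) (L M : lieAlgType K) :
  lie_isomorphic L M -> ad_nil_sqr0 M -> ad_nil_sqr0 L.
Proof.
move=> [f [[g fK gK] fB]] nilM x x3 y; apply: (can_inj fK).
rewrite !fB linear0; apply: nilM => z.
by rewrite -(gK z) -!fB x3 linear0.
Qed.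

Lemma ad_nil_sqr0_pair (K : fieldType) (L M : lieAlgType K) :
  ad_nil_sqr0 L -> ad_nil_sqr0 M -> ad_nil_sqr0 (L * M)%type.
Proof.
move=> nilL nilM [x1 x2] x3 [y1 y2]; congr (_, _).
  by apply: nilL => z; have := x3 (z, 0) => /(congr1 fst).
by apply: nilM => z; have := x3 (0, z) => /(congr1 snd).
Qed.

Lemma ad_nil_sqr0_ffun (K : fieldType) (I : finType) (L : lieAlgType K) :
  ad_nil_sqr0 L -> ad_nil_sqr0 {ffun I -> L}.
Proof.
move=> nilL x x3 y; apply/ffunP => i; rewrite !ffunE; apply: nilL => z.
by have /ffunP/(_ i) := x3 [ffun=> z]; rewrite !ffunE.
Qed.

Lemma affR_ad_nil_sqr0 (K : fieldType) : ad_nil_sqr0 (affR K).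
Proof.
move=> x x3.
have x0 : x 0 0 = 0.
  (* The bracket with x multiplies e_2 by [x 0 0]. *)
  have /rowP/(_ 1) := x3 (delta_mx 0 1); rewrite !mxE /= => x0.
  have /eqP : x 0 0 ^+ 3 = 0 by rewrite -[RHS]x0; ring.
  by rewrite expf_eq0 => /eqP.
by move=> y; apply/rowP; case=> -[|[|//]] ?; rewrite !mxE /= ?x0; ring.
Qed.

Lemma affC_ad_nil_sqr0 (R : rcfType) : ad_nil_sqr0 (affC R).
Proof.
move=> x x3.
have /eqP : (x 0 0 ^+ 2 + x 0 1 ^+ 2) ^+ 3 = 0.
  have X3 := x3 (delta_mx 0 2).
  have /rowP/(_ 2) := X3; rewrite !mxE /= => re.
  have /rowP/(_ 3) := X3; rewrite !mxE /= => im.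
  (* On the span of e_3 and e_4 the bracket with x is multiplication by z = x_0 + i x_1. The two
     squares are those of the real and imaginary parts of z^3, and |z^3|^2 = |z|^6. *)
  transitivity ((x 0 0 ^+ 3 - 3%:R * x 0 0 * x 0 1 ^+ 2) ^+ 2 +
    (3%:R * x 0 0 ^+ 2 * x 0 1 - x 0 1 ^+ 3) ^+ 2); first by ring.
  rewrite [X in X ^+ 2 + _](_ : _ = 0); last by rewrite -[RHS]re; ring.
  rewrite [X in _ + X ^+ 2](_ : _ = 0); last by rewrite -[RHS]im; ring.
  by rewrite expr0n addr0.
rewrite expf_eq0 /= paddr_eq0 ?sqr_ge0 // !sqrf_eq0 => /andP[/eqP x0 /eqP x1] y.
by apply/rowP; case=> -[|[|[|[|//]]]] ?; rewrite !mxE /= ?x0 ?x1; ring.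
Qed.

Lemma ad_nil_sqr0_reduced (K : fieldType) n (phi : 'M[K]_n.+1) :
  ad_nil_sqr0 (semidirect phi) -> reduced_polyalg phi.
Proof.
move=> nilG b bA bb; apply: eq_mulmx_cV => v; rewrite mul0mx.
(* (ad x)^2 sends (a, w) to (0, - b a v). It depends only on a, which is 0 for a bracket, so (ad
   x)^3 = 0; at (1, 0) it yields - b v. *)
pose x : semidirect phi := (vsproj (polyalg phi) b, v).
have xx y : bracket x (bracket x y) = (0, - (b *m vsval y.1 *m v)).
  rewrite !semidirectE /= vsprojK // mul0mx subr0.
  by rewrite mulmxBr !mulmxA bb mul0mx sub0r.
have x3 y : bracket x (bracket x (bracket x y)) = 0.
  by rewrite xx semidirectE /= mulmx0 mul0mx oppr0.
have := nilG x x3 (vsproj (polyalg phi) 1%:M, 0).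
rewrite xx /= vsprojK ?one_polyalg // mulmx1 => /(congr1 snd) /= /eqP.
by rewrite oppr_eq0 => /eqP.
Qed.

(** * Dimension counts *)

Lemma inj_linear_bij (K : fieldType) (V W : vectType K) (f : {linear V -> W}) :
  injective f -> (\dim {:W} <= \dim {:V})%N -> bijective f.
Proof.
move=> injf dimWV; pose h := linfun f.
have hE x : h x = f x by rewrite lfunE.
have kerh : lker h == 0%VS by apply/lker0P => x y; rewrite !hE => /injf.
have imh : limg h = fullv.
  by apply/eqP; rewrite eqEdim subvf limg_dim_eq // (eqP kerh) capv0.
exists (h^-1)%VF => x; rewrite -hE; first exact: lker0_lfunK.
by apply: limg_lfunVK; rewrite imh memvf.
Qed.

(** Evaluation at [phi] is injective on polynomials of degree below that of the minimal polynomial.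
    The bound later makes the weight map onto. *)
Lemma dim_polyalg (K : fieldType) n (phi : 'M[K]_n.+1) :
  nonderogatory phi -> (n.+1 <= \dim (polyalg phi))%N.
Proof.
move=> ndphi; pose d := degree_mxminpoly phi.
suff: (d <= \dim (polyalg phi))%N.
  congr (_ <= _)%N.
  by apply: succn_inj; rewrite -size_mxminpoly -ndphi size_char_poly.
pose f := linfun (horner_mx phi \o @rVpoly K d).
have kerf : lker f == 0%VS.
  by apply/lker0P => u v; rewrite !lfunE; apply: horner_rVpoly_inj.
have <- : \dim (limg f) = d.
  by rewrite limg_dim_eq ?(eqP kerf) ?capv0 // dimvf dim_matrix; exact: mul1n.
apply: dimvS; apply/subvP => _ /memv_imgP[u _ ->].
by rewrite lfunE /=; apply/polyalgP; eexists.
Qed.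

(** * Decomposition into copies of aff(R) and aff(C) *)

Section Decomposition.
Context (R : rcfType) (n : nat) (phi : 'M[R]_n.+1).
Local Notation C := (complex R).
Local Notation rc := (real_complex R).
Local Notation "M ^C" := (map_mx rc M).
Local Notation G := (semidirect phi).

(** The case split makes the choice of eigenvectors compatible with conjugation: real rows for real
    [l], conjugate rows for conjugate nonreal [l]. *)
Definition eigenrow (l : C) : 'rV[C]_n.+1 :=
  if complex.Im l == 0 then (nz_row (eigenspace phi (complex.Re l)))^C
  else if 0 < complex.Im l then nz_row (eigenspace phi^C l)
  else map_mx (@conjc R) (nz_row (eigenspace phi^C (conjc l))).

Lemma map_conjc_real m1 m2 (M : 'M[R]_(m1, m2)) : map_mx (@conjc R) M^C = M^C.
Proof. by apply/matrixP=> i j; rewrite !mxE conjc_real. Qed.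

Lemma eigenvalue_conj l : eigenvalue phi^C l -> eigenvalue phi^C (conjc l).
Proof.
move/eigenvalueP => [v vphi v0]; apply/eigenvalueP.
exists (map_mx (@conjc R) v); last by rewrite map_mx_eq0.
by rewrite -(map_conjc_real phi) -map_mxM vphi map_mxZ.
Qed.

Lemma eigenvalue_real l :
  complex.Im l = 0 -> eigenvalue phi^C l -> eigenvalue phi (complex.Re l).
Proof.
move=> l0; rewrite !eigenvalue_root_char -map_char_poly.
have -> : l = rc (complex.Re l) by case: l l0 => a b /= ->.
by rewrite fmorph_root.
Qed.

Lemma eigenrow_neq0 l : eigenvalue phi^C l -> eigenrow l != 0.
Proof.
rewrite /eigenrow; case: (complex.Im l =P 0) => [l0 | _ eig_l].
  by move/(eigenvalue_real l0); rewrite map_mx_eq0 nz_row_eq0.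
case: ifP => _; first by rewrite nz_row_eq0.
by rewrite map_mx_eq0 nz_row_eq0; apply: eigenvalue_conj.
Qed.

Lemma eigenrowP l : eigenrow l *m phi^C = l *: eigenrow l.
Proof.
rewrite /eigenrow; case: (complex.Im l =P 0) => [l0 | _].
  rewrite -map_mxM (eigenspaceP (nz_row_sub _)) map_mxZ.
  by congr (_ *: _); case: l l0 => a b /= ->.
case: ifP => _; first exact: (eigenspaceP (nz_row_sub _)).
rewrite -[X in _ *m X](map_conjc_real phi) -map_mxM.
by rewrite (eigenspaceP (nz_row_sub _)) map_mxZ /= conjcK.
Qed.

Lemma ImJ (l : C) : complex.Im (conjc l) = - complex.Im l.
Proof. by case: l. Qed.

Lemma eigenrow_conj l : 0 < complex.Im l ->
  eigenrow (conjc l) = map_mx (@conjc R) (eigenrow l).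
Proof.
move=> l_gt0.
by rewrite /eigenrow conjcK ImJ oppr_eq0 oppr_gt0 gt_eqF // lt_gtF // l_gt0.
Qed.

(** The eigenvalue of [a] on [eigenrow l], obtained by evaluating at [l] a real polynomial that
    represents [a]; this makes it linear in [a] and compatible with conjugation. *)
Definition eigenchar (l : C) (a : subvs_of (polyalg phi)) : C :=
  (map_poly rc (mx_inv_horner phi (vsval a))).[l].

Definition eigencoord (l : C) (x : 'cV[R]_n.+1) : C := (eigenrow l *m x^C) 0 0.

Lemma eigencharP l a : eigenrow l *m (vsval a)^C = eigenchar l a *: eigenrow l.
Proof.
have [p aE] : exists p, vsval a = horner_mx phi p by apply/polyalgP/subvsP.
have -> : (vsval a)^C =
    horner_mx phi^C (map_poly rc (mx_inv_horner phi (vsval a))).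
  by rewrite -map_horner_mx mx_inv_hornerK // aE horner_mx_mem.
exact: horner_mx_eigen (eigenrowP l).
Qed.

Lemma eigenchar_linear l k a b :
  eigenchar l (k *: a + b) = rc k * eigenchar l a + eigenchar l b.
Proof.
rewrite /eigenchar /mx_inv_horner !linearP /= mulmxDl -scalemxAl linearP /=.
rewrite rmorphD /= map_polyZ.
by rewrite hornerD hornerZ.
Qed.

Lemma eigencoord_linear l k x y :
  eigencoord l (k *: x + y) = rc k * eigencoord l x + eigencoord l y.
Proof.
by rewrite /eigencoord map_mxD map_mxZ mulmxDr -scalemxAr !mxE.
Qed.

Lemma eigencoordM l a x :
  eigencoord l (vsval a *m x) = eigenchar l a * eigencoord l x.
Proof.
by rewrite /eigencoord map_mxM mulmxA eigencharP -scalemxAl mxE.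
Qed.

Lemma eigenchar_conj l a : eigenchar (conjc l) a = conjc (eigenchar l a).
Proof.
rewrite /eigenchar -(horner_map (@conjc R)) -map_poly_comp; congr (_.[_]).
by apply: eq_map_poly => z; apply: (esym (conjc_real z)).
Qed.

Lemma eigencoord_conj l x : 0 < complex.Im l ->
  eigencoord (conjc l) x = conjc (eigencoord l x).
Proof.
move=> l_gt0; rewrite /eigencoord eigenrow_conj //.
rewrite -(map_conjc_real x) -map_mxM mxE.
by rewrite map_conjc_real.
Qed.

Lemma Im_eigenchar l a : complex.Im l = 0 -> complex.Im (eigenchar l a) = 0.
Proof.
move=> l0; have := eigenchar_conj l a.
have -> : conjc l = l by case: l l0 => r i /= ->; rewrite oppr0.
case: (eigenchar l a) => r i [/eqP].
by rewrite -addr_eq0 -mulr2n mulrn_eq0 => /eqP.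
Qed.

Lemma Im_eigencoord l x : complex.Im l = 0 -> complex.Im (eigencoord l x) = 0.
Proof.
by move=> l0; rewrite /eigencoord /eigenrow l0 eqxx -map_mxM mxE.
Qed.

Lemma Re_linear k (z w : C) :
  complex.Re (rc k * z + w) = k * complex.Re z + complex.Re w.
Proof. by case: z w => [a b] [c d] /=; rewrite mul0r subr0. Qed.

Lemma Im_linear k (z w : C) :
  complex.Im (rc k * z + w) = k * complex.Im z + complex.Im w.
Proof. by case: z w => [a b] [c d] /=; rewrite mul0r addr0. Qed.

(** Meant for [sr] the real eigenvalues and [sh] those with positive imaginary part, one from each
    conjugate pair. At real eigenvalues the imaginary parts vanish and are dropped. *)
Definition weight_map (sr sh : seq C) (g : G) :
    ({ffun 'I_(size sr) -> affR R} * {ffun 'I_(size sh) -> affC R})%type :=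
  ([ffun i : 'I_(size sr) => \row_k
     [:: complex.Re (eigenchar sr`_i g.1);
         complex.Re (eigencoord sr`_i g.2)]`_k],
   [ffun i : 'I_(size sh) => \row_k
     [:: complex.Re (eigenchar sh`_i g.1); complex.Im (eigenchar sh`_i g.1);
         complex.Re (eigencoord sh`_i g.2);
         complex.Im (eigencoord sh`_i g.2)]`_k]).

Lemma weight_map_linear sr sh : linear (weight_map sr sh).
Proof.
move=> k g h; congr (_, _); apply/ffunP => i; rewrite !ffunE; apply/rowP.
  case=> -[|[|//]] ?; rewrite !mxE /=.
    by rewrite eigenchar_linear Re_linear.
  by rewrite eigencoord_linear Re_linear.
case=> -[|[|[|[|//]]]] ?; rewrite !mxE /=.
- by rewrite eigenchar_linear Re_linear.
- by rewrite eigenchar_linear Im_linear.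
- by rewrite eigencoord_linear Re_linear.
- by rewrite eigencoord_linear Im_linear.
Qed.

HB.instance Definition _ sr sh :=
  GRing.isLinear.Build R G _ _ (weight_map sr sh) (@weight_map_linear sr sh).

Lemma eigenchar0 l : eigenchar l 0 = 0.
Proof. by rewrite /eigenchar mx_inv_horner0 rmorph0 horner0. Qed.

(** In complex coordinates this is the bracket of aff(C). *)
Lemma eigencoord_bracket l (g h : G) :
  eigencoord l (bracket g h).2 =
    eigenchar l g.1 * eigencoord l h.2 - eigenchar l h.1 * eigencoord l g.2.
Proof.
rewrite semidirectE /=.
have := eigencoord_linear l (-1) (vsval h.1 *m g.2) (vsval g.1 *m h.2).
by rewrite scaleN1r rmorphN1 mulN1r !eigencoordM ![- _ + _]addrC.
Qed.

Lemma weight_map_bracket sr sh g h : {in sr, forall l, complex.Im l = 0} ->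
  weight_map sr sh (bracket g h) =
    bracket (weight_map sr sh g) (weight_map sr sh h).
Proof.
move=> sr_real; rewrite /weight_map; congr (_, _); apply/ffunP => i.
  have Imchar x := Im_eigenchar x (sr_real _ (mem_nth 0 (ltn_ord i))).
  rewrite !ffunE; apply/rowP; case=> -[|[|//]] ?; rewrite !mxE /=.
    by rewrite eigenchar0.
  rewrite eigencoord_bracket.
  (* As the characters are real, taking real parts commutes with these products. *)
  move: (Imchar g.1) (Imchar h.1).
  case: (eigenchar _ g.1) (eigenchar _ h.1).
  move=> a b [c d]; case: (eigencoord _ g.2) (eigencoord _ h.2) => e f [k l] /=.
  by move=> -> ->; ring.
rewrite !ffunE; apply/rowP; case=> -[|[|[|[|//]]]] ?; rewrite !mxE /=.
- by rewrite eigenchar0.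
- by rewrite eigenchar0.
- rewrite eigencoord_bracket.
  case: (eigenchar _ g.1) (eigenchar _ h.1).
  move=> a b [c d]; case: (eigencoord _ g.2) (eigencoord _ h.2) => e f [k l] /=.
  by ring.
- rewrite eigencoord_bracket.
  case: (eigenchar _ g.1) (eigenchar _ h.1).
  move=> a b [c d]; case: (eigencoord _ g.2) (eigencoord _ h.2) => e f [k l] /=.
  by ring.
Qed.

(** With p and q the two sizes, the target has dimension 2 p + 4 q = 2 (p + 2 q), and the source at
    least 2 (n + 1) by [dim_polyalg]. *)
Lemma weight_map_dim (sr sh : seq C) : nonderogatory phi ->
  (size sr + (size sh).*2 <= n.+1)%N ->
  (\dim {: ({ffun 'I_(size sr) -> affR R} * {ffun 'I_(size sh) -> affC R})%type}
     <= \dim {: G})%N.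
Proof.
move=> ndphi les; have dimA := dim_polyalg ndphi.
rewrite !dimvf.
have -> : dim G = (\dim (polyalg phi) + n.+1 * 1)%N by [].
have -> :
  dim ({ffun 'I_(size sr) -> affR R} * {ffun 'I_(size sh) -> affC R})%type =
  (#|'I_(size sr)| * (1 * 2) + #|'I_(size sh)| * (1 * 4))%N by [].
rewrite !card_ord !mul1n muln1 (leq_trans _ (leq_add dimA (leqnn _))) //.
by rewrite addnn -leq_double doubleD -!muln2 -mulnA in les *.
Qed.

Lemma weight_map_inj (s sr sh : seq C) :
  uniq s -> size s = n.+1 -> {in s, forall l, eigenvalue phi^C l} ->
  {in s, forall l, [\/ l \in sr, l \in sh | conjc l \in sh]} ->
  {in sr, forall l, complex.Im l = 0} -> {in sh, forall l, 0 < complex.Im l} ->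
  injective (weight_map sr sh).
Proof.
move=> uniq_s size_s eig_s sP srP shP.
pose lam (i : 'I_n.+1) := s`_i.
have s_lam i : lam i \in s by rewrite mem_nth ?size_s.
have inj_lam : injective lam.
  by move=> i j /eqP; rewrite nth_uniq ?size_s // => /eqP/val_inj.
pose U := \matrix_i eigenrow (lam i).
have unitU : U \in unitmx.
  apply: (eigenbasis_unit (phi := phi^C) inj_lam) => i; rewrite rowK.
    exact/eigenrow_neq0/eig_s/s_lam.
  exact: eigenrowP.
apply: raddf_inj => -[a x] wax0.
have sr0 l : l \in sr -> eigenchar l a = 0 /\ eigencoord l x = 0.
  move=> l_sr; have l0 := srP l l_sr; have /(nthP 0)[k k_lt lE] := l_sr.
  have /ffunP/(_ (Ordinal k_lt))/rowP w0 := congr1 fst wax0.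
  have := w0 0; have := w0 1; rewrite !ffunE !mxE /= lE.
  move: (Im_eigenchar a l0) (Im_eigencoord x l0).
  by case: (eigenchar l a) (eigencoord l x) => [? ?] [? ?] /= -> -> -> ->.
have sh0 l : l \in sh -> eigenchar l a = 0 /\ eigencoord l x = 0.
  move=> l_sh; have /(nthP 0)[k k_lt lE] := l_sh.
  have /ffunP/(_ (Ordinal k_lt))/rowP w0 := congr1 snd wax0.
  have := w0 0; have := w0 1; have := w0 2; have := w0 3.
  rewrite !ffunE !mxE /= lE.
  by case: (eigenchar l a) (eigencoord l x) => [? ?] [? ?] /= -> -> -> ->.
(* Conjugation reaches the eigenvalues with negative imaginary part. As the eigenrows form a basis,
   a and x then vanish. *)
have s0 l : l \in s -> eigenchar l a = 0 /\ eigencoord l x = 0.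
  case/sP => [/sr0 // | /sh0 // | l_sh].
  rewrite -[l]conjcK eigenchar_conj eigencoord_conj ?shP //.
  by case: (sh0 _ l_sh) => -> ->; rewrite conjc0.
congr (_, _).
  apply/val_inj; apply: (map_mx_inj (f := rc)); apply: (can_inj (mulKmx unitU)).
  rewrite map_mx0 mulmx0; apply/row_matrixP => i.
  by rewrite row_mul rowK eigencharP (s0 _ (s_lam i)).1 scale0r row0.
apply: (map_mx_inj (f := rc)); apply: (can_inj (mulKmx unitU)).
rewrite map_mx0 mulmx0; apply/row_matrixP => i; apply/rowP => j.
by rewrite row_mul rowK row0 !ord1 [LHS](s0 _ (s_lam i)).2 mxE.
Qed.

Lemma distinct_decomposition :
  nonderogatory phi -> distinct_eigenvalues phi ->
  exists p q : nat,
    lie_isomorphic G ({ffun 'I_p -> affR R} * {ffun 'I_q -> affC R})%type.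
Proof.
move=> ndphi [s [uniq_s size_s eig_s]].
have conj_s l : l \in s -> conjc l \in s.
  (* The n + 1 distinct eigenvalues in [s] exhaust the roots of the real characteristic polynomial,
     so [s] is stable under conjugation. *)
  have chiE : char_poly phi^C = \prod_(z <- s) ('X - z%:P).
    rewrite [LHS](all_roots_prod_XsubC (rs := s)) ?uniq_rootsE //.
    - by rewrite (monicP (char_poly_monic _)) scale1r.
    - by rewrite size_char_poly size_s.
    - by apply/allP => z /eig_s; rewrite eigenvalue_root_char.
  move=> /eig_s/eigenvalue_conj.
  by rewrite eigenvalue_root_char chiE root_prod_XsubC.
pose sr := [seq l <- s | complex.Im l == 0].
pose sh := [seq l <- s | 0 < complex.Im l].
have srP : {in sr, forall l, complex.Im l = 0}.
  by move=> l; rewrite mem_filter => /andP[/eqP].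
have shP : {in sh, forall l, 0 < complex.Im l}.
  by move=> l; rewrite mem_filter => /andP[].
have sP : {in s, forall l, [\/ l \in sr, l \in sh | conjc l \in sh]}.
  move=> l ls; rewrite !mem_filter conj_s ls // !andbT.
  rewrite ImJ oppr_gt0; case: (ltgtP (complex.Im l) 0) => _.
  - exact: Or33.
  - exact: Or32.
  - exact: Or31.
have injw := weight_map_inj uniq_s size_s eig_s sP srP shP.
(* [sr], [sh] and the conjugates of [sh] are pairwise disjoint parts of [s], told apart by the sign
   of the imaginary part. *)
have size_srh : (size sr + (size sh).*2 <= n.+1)%N.
  rewrite -size_s -addnn -{2}(size_map (@conjc R) sh) -!size_cat.
  apply: uniq_leq_size => [|l]; last first.
    rewrite !mem_cat !mem_filter => /or3P[/andP[]//|/andP[]//|/mapP[m]].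
    by rewrite mem_filter => /andP[_ /conj_s ms ->].
  rewrite !cat_uniq (map_inj_uniq (inv_inj (@conjcK R))).
  rewrite !filter_uniq ?uniq_s //=.
  rewrite andbT; apply/andP; split; apply/hasPn => l /=.
    rewrite mem_cat => l_shs; apply/negP => /srP l0; case/orP: l_shs.
      by move=> /shP; rewrite l0 ltxx.
    case/mapP => m /shP m_gt0 lE; move: m_gt0.
    by rewrite -[m]conjcK -lE ImJ l0 oppr0 ltxx.
  case/mapP => m /shP m_gt0 ->; apply/negP => /shP.
  by rewrite ImJ oppr_gt0 lt_gtF.
have bij_w := inj_linear_bij injw (weight_map_dim ndphi size_srh).
exists (size sr), (size sh), (weight_map sr sh); split=> //.
by move=> g h; apply: weight_map_bracket.
Qed.
End Decomposition.

(** * The cycle of implications from (1) through (5) back to (1) *)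

Theorem theorem5 (R : realType) (n : nat) (phi : 'M[R]_n.+1)
    (phi_nonderogatory : nonderogatory phi) :
  [<-> (* (1) *) forall D : 'End(semidirect phi),
                   derivation D -> inner_derivation D;
       (* (2) *) cartan_subalgebra (polyalg phi);
       (* (3) *) distinct_eigenvalues phi;
       (* (4) *) exists N : {vspace semidirect phi},
                   is_nilradical N /\ lie_abelian N;
       (* (5) *) exists p q : nat,
                   lie_isomorphic (semidirect phi)
                     ({ffun 'I_p -> affR R} * {ffun 'I_q -> affC R})%type].
Proof.
have red3 := reduced_distinct phi_nonderogatory.
tfae.
- exact: complete_cartan.
- by move/cartan_reduced/red3.
- by move/distinct_reduced/reduced_nilradical.
- by move/nilradical_reduced/red3/distinct_decomposition; apply.
- move=> [p [q iso]].
  apply/cartan_complete/distinct_cartan/red3/ad_nil_sqr0_reduced.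
  apply: ad_nil_sqr0_iso iso _; apply: ad_nil_sqr0_pair.
    exact/ad_nil_sqr0_ffun/affR_ad_nil_sqr0.
  exact/ad_nil_sqr0_ffun/affC_ad_nil_sqr0.
Qed.
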